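(* Let $T$ be a finite tree, and let $X$ be a tree-indexed Markov chain on $T$ with parameters $((r_v)_{v\in V(T)},(p_e)_{e\in E(T)})$ such that $P(X(V(T))\equiv0)>0$. Let $\nu$ be the unique signed measure corresponding to $X$. Then, for any non-empty $S\subseteq V(T)$, we have $$\nu(S)=\begin{cases}\displaystyle\sum_{J\subseteq\mathcal{B}^-(S)}(-1)^{|J|}\log P\bigl(X(J\cup(\mathcal{B}^+(S)\setminus\partial_SJ))\equiv0\bigr)&\text{if }S\text{ is connected and }|S|\ge2,\\[2mm]-\log P\bigl(X(S\cup\mathcal{B}^+(S))\equiv0\mid X(\mathcal{B}^+(S))\equiv0\bigr)&\text{if }S=\{v\}\text{ for some }v\in V(T),\\ 0&\text{otherwise.}\end{cases}$$
   Context: Graph notation. $v\sim v'$ means neighbors; a vertex set is connected if it induces a connected subgraph. For $S\subseteq V(T)$: $\mathcal{B}^-(S)=\{v\in S:|\{v'\in S:v\sim v'\}|=1\}$ (inner boundary), $\mathcal{B}^+(S)=\{v\in V(T)\setminus S:\exists v'\in S,\ v\sim v'\}$ (outer boundary), and for $J\subseteq S$, $\partial_SJ=\{v\in\mathcal{B}^+(S):\exists v'\in J,\ v\sim v'\}$. $X(A)\equiv0$ means $X(v)=0$ for all $v\in A$. Tree-indexed Markov chain with general parameters. Let $T$ be a tree, $r_v\in[0,1]$ for $v\in V(T)$, $p_e\in[0,1]$ for $e\in E(T)$, and fix a root $o\in V(T)$. Let $(R_v)$ be independent with $P(R_v=0)=r_v$, $P(R_v=1)=1-r_v$. Set $X(o)=R_o$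 and, moving outwards from $o$, for each $v\ne o$ with parent $v^-$, independently, $X(v)=X(v^-)$ with probability $1-p_{(v^-,v)}$ and $X(v)=R_v$ with probability $p_{(v^-,v)}$. Signed measure corresponding to $X$. For a $\{0,1\}$-valued process $X$ on a finite set $V$ with $P(X(I)\equiv0)>0$ for all nonempty $I\subseteq V$, there is a unique signed measure $\nu$ on $\mathcal{P}(V)\setminus\{\emptyset\}$ with $\nu(\{B:B\cap I\ne\emptyset\})=-\log P(X(I)\equiv0)$ for all $I\subseteq V$, namely $\nu(K)=\sum_{I\subseteq K}(-1)^{|K|-|I|}\log P(X(V\setminus I)\equiv0)$, $\emptyset\neq K\subseteq V$. *)

(* Defs.v *)
From HB Require Import structures.
From mathcomp Require Import all_boot all_order all_algebra.
From mathcomp Require Import all_classical all_reals all_analysis.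

Set Implicit Arguments.
Unset Strict Implicit.
Unset Printing Implicit Defensive.

Import Order.TTheory GRing.Theory Num.Theory.

Local Open Scope ring_scope.

(* A finite simple graph is a symmetric irreflexive relation [adj] on a
   finType; [%SET] marks finite sets, [%classic] arbitrary sets. *)
Section Graphs.
Context {T : finType}.
Implicit Types (adj : rel T) (S J : {set T}).

Definition connected_in adj S : bool :=
  [forall u in S, forall v in S,
     connect [rel x y | [&& x \in S, y \in S & adj x y]] u v].

(* The bound [2] on lengths discards the degenerate closed walks u, v, u. *)
Definition acyclic adj : Prop :=
  forall c : seq T, ucycle adj c -> (size c <= 2)%N.

Definition is_tree adj : Prop :=
  [/\ symmetric adj, irreflexive adj, connected_in adj [set: T]%SET
    & acyclic adj].

Definition inner_boundary adj S : {set T} :=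
  [set v in S | #|[set v' in S | adj v v']%SET| == 1%N]%SET.

Definition outer_boundary adj S : {set T} :=
  [set v in (~: S)%SET | [exists v' in S, adj v v']]%SET.

Definition outer_boundary_at adj S J : {set T} :=
  [set v in outer_boundary adj S | [exists v' in J, adj v v']]%SET.

(* The simple path from [o] to [v] has [u] as its next-to-last vertex. *)
Definition is_parent adj (o u v : T) : Prop :=
  exists s : seq T, [/\ path adj o (rcons s v), uniq (o :: rcons s v)
                      & last o s = u].

End Graphs.

Section Probability.
Local Open Scope classical_set_scope.
Context {d : measure_display} {Omega : measurableType d} {R : realType}
  {P : probability Omega R}.

Definition mutually_independent (I : finType) {d' : measure_display}
    {U : measurableType d'} (Z : I -> {RV P >-> U}) : Prop :=
  forall (J : {set I}) (A : I -> set U), (forall i, measurable (A i)) ->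
    P (\bigcap_(i in [set i | i \in J]) (Z i @^-1` A i))
      = (\prod_(i in J) P (Z i @^-1` A i))%E.

Definition cond_prob (A B : set Omega) : R :=
  fine (P (A `&` B)) / fine (P B).

(* {0,1}-valued processes take values in [bool], with [false] for 0 and [true]
   for 1; [zero_on X A] is the event X(A) = 0. *)
Definition zero_on (T : finType) (X : T -> {RV P >-> bool}) (A : {set T}) :
    set Omega :=
  [set w | forall v, v \in A -> X v w = false].

(* [C v] is the event that [v] takes the fresh value [Rv v] rather than copying
   its parent; [p] is indexed by edges, seen as two-element sets. *)
Definition tree_markov_chain (T : finType) (adj : rel T) (o : T)
    (r : T -> R) (p : {set T} -> R) (X : T -> {RV P >-> bool}) : Prop :=
  exists (Rv : T -> {RV P >-> bool}) (C : {v : T | v != o} -> {RV P >-> bool}),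
  [/\ mutually_independent
        (fun i : T + {v : T | v != o} =>
           match i with inl v => Rv v | inr v => C v end),
      forall v, P (Rv v @^-1` [set false]) = (r v)%:E /\
                P (Rv v @^-1` [set true]) = (1 - r v)%:E,
      forall (v : {v : T | v != o}) u, is_parent adj o u (sval v) ->
        P (C v @^-1` [set true]) = (p [set u; sval v]%SET)%:E /\
        P (C v @^-1` [set false]) = (1 - p [set u; sval v]%SET)%:E,
      forall w, X o w = Rv o w
    & forall (v : {v : T | v != o}) u, is_parent adj o u (sval v) ->
        forall w, X (sval v) w = if C v w then Rv (sval v) w else X u w].

End Probability.

(* The set of nonempty subsets of [T], with the discrete sigma-algebra. The
   parameter [o] only serves to make this type pointed, as every
   [measurableType] has to be. *)
Definition nonempty_set (T : finType) (o : T) : Type :=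
  {S : {set T} | S != finset.set0}.

Section NonemptySet.
Context {T : finType} (o : T).

Lemma set1_nonempty : [set o]%SET != finset.set0.
Proof. by apply/set0Pn; exists o; rewrite inE. Qed.

HB.instance Definition _ := Finite.on (nonempty_set o).
HB.instance Definition _ := isPointed.Build (nonempty_set o)
  (exist (fun S : {set T} => S != finset.set0) _ set1_nonempty).
HB.instance Definition _ := @isMeasurable.Build default_measure_display
  (nonempty_set o) discrete_measurable discrete_measurable0
  discrete_measurableC discrete_measurableU.

End NonemptySet.

(* At I = set0 both sides are 0. *)
Definition corresponding_signed_measure {d : measure_display}
    {Omega : measurableType d} {R : realType} {P : probability Omega R}
    (T : finType) (o : T) (X : T -> {RV P >-> bool})
    (nu : {charge set (nonempty_set o) -> \bar R}) : Prop :=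
  forall I : {set T},
    nu [set B : nonempty_set o | (sval B :&: I)%SET != finset.set0]%classic
      = (- ln (fine (P (zero_on X I))))%:E.

(* Main.v *)
(** Let f(A) = log P(X(A) = 0). Moebius inversion gives nu(S) as the alternating
    sum over L in S of (-1)^|L| f(~S u L). The Markov property at a vertex c,
    f(A) + f({c}) = f({c} u (A n U)) + f(A \ U) for c in A and U a union of
    components of T - c, makes such an alternating sum vanish as soon as c lies
    in the fixed part of the argument and separates two elements of the summation
    range. With c outside S this settles disconnected S and, for connected S,
    replaces ~S by the outer boundary; with c an inner vertex of S it restricts L
    to sets of leaves. At a leaf j of L, the Markov property splits off the outer
    neighbors of j at the cost of a term depending only on whether j is in L, and
    such terms cancel because S has at least two leaves. *)

Require Import Defs.
From mathcomp Require Import all_boot all_order all_algebra.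
From mathcomp Require Import all_classical all_reals all_analysis.

Set Implicit Arguments.
Unset Strict Implicit.
Unset Printing Implicit Defensive.

Import Order.TTheory GRing.Theory Num.Theory.

Local Open Scope ring_scope.
Local Open Scope set_scope.

(** * Alternating sums over the subsets of a finite set *)

Section AlternatingSums.
Context {T : finType} {R : pzRingType}.
Implicit Types (L B U : {set T}) (g h : {set T} -> R).

Definition altsum B g : R :=
  \sum_(L : {set T} | L \subset B) (-1) ^+ #|L| * g L.

Lemma eq_altsum B g h :
  (forall L, L \subset B -> g L = h L) -> altsum B g = altsum B h.
Proof. by move=> gh; apply: eq_bigr => L /gh ->. Qed.

Lemma altsumD B g h :
  altsum B (fun L => g L + h L) = altsum B g + altsum B h.
Proof. by rewrite -big_split; apply: eq_bigr => L _; rewrite mulrDr. Qed.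

Lemma altsumN B g : altsum B (fun L => - g L) = - altsum B g.
Proof. by rewrite -sumrN; apply: eq_bigr => L _; rewrite mulrN. Qed.

(** The subsets containing [a] are the sets [a |: L] with [L] inside [B], and adding [a] flips the
    sign. *)
Lemma altsum_setU1 a B g : a \notin B ->
  altsum (a |: B) g = altsum B g - altsum B (fun L => g (a |: L)).
Proof.
move=> aB; rewrite /altsum (bigID (fun L => a \in L)) /= addrC; congr (_ + _).
  apply: eq_bigl => L; apply/andP/idP => [[/fintype.subsetP LB aL]|LB].
    apply/fintype.subsetP => x xL; have := LB x xL; rewrite !inE.
    by case: eqP => // xa; rewrite -xa xL in aL.
  rewrite (fintype.subset_trans LB) ?finset.subsetUr //; split=> //.
  by apply: contra aB; apply: (fintype.subsetP LB).
rewrite -sumrN (reindex_onto (fun L => a |: L) (fun L => L :\ a)) /=.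
  apply: eq_big => [L|L /andP[_ /eqP LE]].
    rewrite finset.setU11 andbT; apply/andP/idP => [[LB /eqP LE]|LB].
      apply/fintype.subsetP => x xL; have : x \in a |: B.
        by apply: (fintype.subsetP LB); rewrite !inE xL orbT.
      by move: xL; rewrite -LE !inE => /andP[/negPf -> _].
    rewrite finset.setUS //; split => //; apply/eqP/finset.setU1K.
    by apply: contra aB; apply: (fintype.subsetP LB).
  have aL : a \notin L by rewrite -LE !inE eqxx.
  by rewrite cardsU1 aL exprS mulN1r mulNr.
by move=> L /andP[_ aL]; rewrite finset.setD1K.
Qed.

Lemma altsum0 g : altsum finset.set0 g = g finset.set0.
Proof.
rewrite /altsum (big_pred1 finset.set0) ?cards0 ?expr0 ?mul1r //.
by move=> L; rewrite finset.subset0.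
Qed.

(** The terms of [L] and [a |: L] cancel in pairs. Every vanishing alternating sum below reduces to
    this. *)
Lemma altsum_toggle a B g : a \in B ->
  (forall L, g (a |: L) = g L) -> altsum B g = 0.
Proof.
move=> aB gE; rewrite -(finset.setD1K aB) altsum_setU1 ?setD11 //.
by rewrite (@eq_altsum _ (fun L => g (a |: L)) g) ?subrr.
Qed.

End AlternatingSums.

(** * Branches of a tree *)

Section Tree.
Context {T : finType} (adj : rel T).
Hypotheses (adj_sym : symmetric adj) (adj_irr : irreflexive adj)
  (adj_conn : connected_in adj [set: T]) (adj_acyclic : acyclic adj).
Implicit Types (c u v x y : T) (S : {set T}).

Definition avoid c : rel T := [rel x y | [&& x != c, y != c & adj x y]].

Lemma avoidE c x y : avoid c x y = [&& x != c, y != c & adj x y].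
Proof. by []. Qed.

(** For [x != c] this is the connected component of [x] once [c] is deleted. *)
Definition branch c x : {set T} := [set y | connect (avoid c) x y].

Lemma avoid_connect_sym c : connect_sym (avoid c).
Proof.
apply: sym_connect_sym => x y; rewrite !avoidE.
by rewrite !andbA [(x != c) && _]andbC adj_sym.
Qed.

Lemma path_branch c x s :
  path adj x s -> c \notin x :: s -> last x s \in branch c x.
Proof.
move=> xs cs; rewrite inE; apply/connectP; exists s => //.
elim: s x xs cs => //= y s IHs x /andP[xy ys].
rewrite !inE !negb_or => /and3P[cx cy cs].
by rewrite avoidE ![_ == c]eq_sym cx cy xy IHs // inE negb_or cy.
Qed.

Lemma center_notin_branch c x : x != c -> c \notin branch c x.
Proof.
move=> xc; rewrite inE; apply/negP => /connectP[s].
case/lastP: s => [_ /= cx|s z]; first by rewrite cx eqxx in xc.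
by rewrite rcons_path last_rcons avoidE => /andP[_ /and3P[_ /negP cz _]] /esym /eqP.
Qed.

Lemma branch_closed c x y z :
  x != c -> y \in branch c x -> adj y z -> z != c -> z \in branch c x.
Proof.
move=> xc yb yz zc; have yc : y != c.
  by apply: contraTneq yb => ->; apply: center_notin_branch.
move: yb; rewrite !inE => /connect_trans; apply; apply: connect1.
by rewrite avoidE yc zc.
Qed.

(** If [x != y], a simple path from [x] to [y] avoiding [c], closed up through [c], would be a cycle
    with at least three vertices. *)
Lemma neighbors_branch c x y :
  adj c x -> adj c y -> y \in branch c x -> x = y.
Proof.
move=> cx cy; rewrite inE => /connectP[s xs ys].
case: (shortenP xs) ys => {xs}s' xs us _ ys.
have {xs}[xs' cs] : path adj x s' /\ c \notin x :: s'.
  have : x != c by apply: contraTneq cx => ->; rewrite adj_irr.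
  elim: s' x xs {us ys cx} => [x _ xc|z s' IHs x]; first by rewrite inE eq_sym.
  rewrite [path _ _ _]/= avoidE => /andP[/and3P[_ zc xz] zs] xc.
  by have [zs' cs] := IHs _ zs zc; rewrite /= xz inE negb_or eq_sym xc.
have := adj_acyclic (c := c :: x :: s').
rewrite /ucycle cons_uniq cs us /= rcons_path cx xs' -ys adj_sym cy => /(_ isT).
by case: s' ys {us xs' cs}.
Qed.

(** The vertices just before and just after [c] on the path are neighbors of [c]. If the two ends
    shared a branch, so would these neighbors, which would then coincide, against simplicity of the
    path. *)
Lemma path_separates c u s :
  path adj u s -> uniq (u :: s) -> c \in s -> c != last u s ->
  last u s \notin branch c u.
Proof.
move=> + + cs; case/splitPr: s / cs => s1 [|y s2].
  by rewrite last_cat /= eqxx.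
rewrite cat_path -cat_cons cat_uniq last_cat => /andP[us1 /= /and3P[dc cy ys2]].
move=> /and3P[_]; rewrite negb_or => /andP[cs1].
rewrite negb_or => /andP[yn _] /and3P[cn _ _] _.
apply/negP; rewrite inE => uv.
have du : connect (avoid c) (last u s1) u.
  by rewrite avoid_connect_sym; have := path_branch us1 cs1; rewrite inE.
have vy : connect (avoid c) (last y s2) y.
  by rewrite avoid_connect_sym; have := path_branch ys2 cn; rewrite inE.
have dy : last u s1 = y.
  apply: (@neighbors_branch c) => //; first by rewrite adj_sym.
  by rewrite inE (connect_trans du) // (connect_trans uv).
by move/negP: yn; apply; rewrite -dy mem_last.
Qed.

Lemma connected_in_path S u v : connected_in adj S -> u \in S -> v \in S ->
  exists s, [/\ path adj u s, uniq (u :: s), last u s = v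
              & {subset u :: s <= S}].
Proof.
move=> Sc uS vS; have /connectP[s us vE] := forall_inP (forall_inP Sc u uS) v vS.
case: (shortenP us) vE => {us}s' us uu _ vE; exists s'; split=> //.
  by apply: sub_path us => x y /and3P[].
elim: s' u uS us {uu vE} => /= [u uS _ x|y s' IHs u uS /andP[/and3P[_ yS _] ys] x].
  by rewrite inE => /eqP ->.
by rewrite inE => /orP[/eqP ->//|]; apply: IHs.
Qed.

Lemma tree_path u v :
  exists s, [/\ path adj u s, uniq (u :: s) & last u s = v].
Proof.
have [s [? ? ? _]] := connected_in_path adj_conn (finset.in_setT u) (finset.in_setT v).
by exists s.
Qed.

Lemma connected_in_branch S c u :
  connected_in adj S -> c \notin S -> u \in S -> S \subset branch c u.
Proof.
move=> Sc cS uS; apply/fintype.subsetP => v vS.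
have [s [us _ <- sS]] := connected_in_path Sc uS vS.
by apply: path_branch us _; apply: contra cS; apply: sS.
Qed.

Lemma connected_in_neighbor S u : connected_in adj S -> u \in S ->
  (1 < #|S|)%N -> exists2 v, v \in S & adj u v.
Proof.
move=> Sc uS S2; have /set0Pn[v] : S :\ u != finset.set0.
  by rewrite -card_gt0; move: S2; rewrite (cardsD1 u) uS.
rewrite !inE => /andP[vu vS].
have [[|y s] [us _ vE sS]] := connected_in_path Sc uS vS.
  by rewrite -vE eqxx in vu.
exists y; last by case/andP: us.
by apply: sS; rewrite !inE eqxx orbT.
Qed.

Lemma inner_boundary_subset S : inner_boundary adj S \subset S.
Proof. by apply/fintype.subsetP => v; rewrite inE => /andP[]. Qed.

(* The last vertex of a maximal simple path in S is a leaf of S. *)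
Lemma branch_leaf S c x : c \in S -> x \in S -> adj c x ->
  exists2 l, l \in inner_boundary adj S & l \in branch c x.
Proof.
move=> cS xS cx.
(* The simple path [c :: x :: s] is extended until it ends at a leaf. Its [size s + 2] distinct
   vertices keep [#|T| - size s] positive, and each extension lowers that number. *)
have ext n s : (#|T| - size s <= n)%N -> path adj c (x :: s) ->
    uniq (c :: x :: s) -> {subset c :: x :: s <= S} ->
    exists2 l, l \in inner_boundary adj S & l \in branch c x.
  elim: n s => [|n IHn] s sn cs us sS.
    have := max_card (mem (c :: x :: s)); rewrite (card_uniqP us) /=.
    move=> cT; move: sn; rewrite leqn0 subn_eq0 => /(leq_trans cT).
    by rewrite ltnNge leqnSn.
  pose l := last x s; pose d := last c (belast x s).
  have lS : l \in S by apply: sS; rewrite inE mem_last orbT.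
  have xsE : x :: s = rcons (belast x s) l by rewrite lastI.
  have lb : l \in branch c x.
    by apply: path_branch; [case/andP: cs | case/andP: us].
  have dl : adj d l by move: cs; rewrite xsE rcons_path => /andP[].
  have dS : d \in S.
    apply: sS; rewrite xsE -rcons_cons mem_rcons inE; apply/orP; right.
    exact: mem_last.
  have [lB|lB] := boolP (l \in inner_boundary adj S); first by exists l.
  have : #|[set v' in S | adj l v']| != 1%N by move: lB; rewrite inE lS.
  rewrite (cardsD1 d) !inE dS adj_sym dl /= eqSS -lt0n card_gt0 => /set0Pn[z].
  rewrite !inE => /and3P[zd zS lz].
  have [zs|zs] := boolP (z \in c :: x :: s); last first.
    apply: (IHn (rcons s z)).
    - by rewrite size_rcons subnS -ltnS; case: (#|T| - size s)%N sn.
    - by rewrite -rcons_cons rcons_path cs.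
    - by rewrite -!rcons_cons rcons_uniq zs.
    - by move=> y; rewrite -!rcons_cons mem_rcons inE => /orP[/eqP ->|/sS].
  have zl : z != l by apply: contraTneq lz => ->; rewrite adj_irr.
  (* A neighbor [z] of [l] already on the path closes a cycle from [z] to [l]. Acyclicity makes [z]
     the predecessor [d] of [l], which is excluded. *)
  have : exists s1 s2, c :: x :: s = s1 ++ z :: rcons s2 l.
    have [s1 [s2 E]] : exists s1 s2, c :: x :: s = s1 ++ z :: s2.
      by case/splitPr: (c :: x :: s) / zs => s1 s2; exists s1, s2.
    have lE : last z s2 = l.
      by have := congr1 (last c) E; rewrite last_cat /= => <-.
    case/lastP: s2 E lE => [_ /= zE|s2 t E]; first by rewrite zE eqxx in zl.
    by rewrite last_rcons => <-; exists s1, s2.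
  case=> s1 [s2 E].
  have zs2 : path adj z (rcons s2 l).
    move: cs; rewrite -[path _ _ _]/(sorted adj (c :: x :: s)) E.
    by case: (s1) => //= a s1'; rewrite cat_path /= => /and3P[].
  have uz : uniq (z :: rcons s2 l) by move: us; rewrite E cat_uniq => /and3P[].
  have := adj_acyclic (c := z :: rcons s2 l).
  rewrite /ucycle uz /= rcons_path zs2 last_rcons lz => /(_ isT).
  rewrite size_rcons; case: s2 E {zs2 uz} => // E _.
  case/eqP: zd; rewrite /d.
  move: E; rewrite xsE -rcons_cons.
  rewrite -(cats1 (c :: _)) -[[:: z; l]]/([:: z] ++ [:: l]) catA.
  by rewrite !cats1 => /rcons_inj[/(congr1 (last c)) /=]; rewrite last_rcons.
apply: (ext #|T| [::]) => //=; first by rewrite subn0.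
- by rewrite cx.
- by rewrite inE andbT; apply: contraTneq cx => ->; rewrite adj_irr.
- by move=> y; rewrite !inE => /orP[]/eqP->.
Qed.

End Tree.

(** * Alternating sums of tree-Markov set functions *)

Section MarkovAlternatingSums.
Context {T : finType} (adj : rel T) {R : pzRingType} (f : {set T} -> R).
Hypotheses (adj_sym : symmetric adj) (adj_irr : irreflexive adj)
  (adj_conn : connected_in adj [set: T]) (adj_acyclic : acyclic adj).
(** Here [U] is a union of components of the tree minus [c]. For f(A) = log P(X(A) = 0) the identity
    is the conditional independence of X(A n U) = 0 and X(A \ U) = 0 given X(c) = 0. *)
Hypothesis f_markov : forall c (U A : {set T}), c \in A -> c \notin U ->
  (forall x y, x \in U -> adj x y -> y != c -> y \in U) ->
  f A + f [set c] = f (c |: (A :&: U)) + f (A :\: U).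
Implicit Types (c u v w x y : T) (A B J K L M Q S U : {set T}).

Lemma markov_branch c x A : c \in A -> x != c ->
  f A = f (c |: (A :&: branch adj c x)) + f (A :\: branch adj c x) - f [set c].
Proof.
move=> cA xc; rewrite -f_markov ?addrK ?center_notin_branch //.
by move=> y z yb yz zc; apply: branch_closed yz zc.
Qed.

(** The Markov property at [c] writes [f (Q :|: L)] as a term blind to [b], a term blind to [a] and
    a constant. Toggling [b] or [a] kills each of them. *)
Lemma altsum_cut c x Q B a b : c \in Q -> x != c ->
  a \in B -> a \in branch adj c x -> b \in B -> b \notin branch adj c x ->
  altsum B (fun L => f (Q :|: L)) = 0.
Proof.
move=> cQ xc aB aU bB bU; pose U := branch adj c x.
rewrite (@eq_altsum _ _ _ _ (fun L => f (c |: ((Q :|: L) :&: U)) +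
  f ((Q :|: L) :\: U) + (- f [set c]))); last first.
  by move=> L _; rewrite (@markov_branch c x) // inE cQ.
rewrite !altsumD [X in X + _ + _](altsum_toggle bB) => [|L]; last first.
  congr (f (_ |: _)); apply/setP => y; rewrite !inE; case: eqP => //= ->.
  by move: bU; rewrite inE => /negPf ->; rewrite !andbF.
rewrite [X in _ + X + _](altsum_toggle aB) => [|L]; last first.
  congr (f _); apply/setP => y; rewrite !inE; case: eqP => //= ->.
  by move: aU; rewrite inE => ->.
by rewrite (altsum_toggle aB) ?addr0.
Qed.

(** The tree path between two vertices not joined inside [S] passes through some [c] outside [S],
    which separates them and lies in the fixed part [~: S]. *)
Lemma altsum_disconnected S : ~~ connected_in adj S ->
  altsum S (fun L => f (~: S :|: L)) = 0.
Proof.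
case/forall_inPn => u uS /forall_inPn[v vS uv].
have [s [us uu vE]] := tree_path adj_conn u v.
have [sS|] := boolP (all (fun y => y \in S) s).
  case/negP: uv; apply/connectP; exists s => //.
  elim: s u us uS sS {uu vE} => //= y s IHs u /andP[uy ys] uS /andP[yS sS].
  by rewrite uS yS uy IHs.
case/allPn => c cs cS.
have cv : c != v by apply: contraNneq cS => ->.
have uc : u != c by apply: contraNneq cS => <-.
apply: (@altsum_cut c u _ _ u v) => //; rewrite ?inE ?cS ?connect0 //.
by have := path_separates adj_sym adj_irr adj_acyclic us uu cs;
  rewrite vE inE => /(_ cv).
Qed.

(** Take for [b] the first vertex outside [S] on a path from [S] to [w]. Being connected and missing
    [b], the set [S] lies in a single branch at [b], and the path ends in another one. *)
Lemma outer_separator S w : connected_in adj S -> S != finset.set0 ->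
  w \notin S -> w \notin outer_boundary adj S ->
  exists b, [/\ b \in outer_boundary adj S, w != b
             & [disjoint S & branch adj b w]].
Proof.
move=> Sc /set0Pn[s0 s0S] wS wB.
have [s [ss us wE]] := tree_path adj_conn s0 w.
have [a [b [s' [aS bS ab [bs us'] wE']]]] : exists a b s',
  [/\ a \in S, b \notin S, adj a b, path adj b s' /\ uniq (a :: b :: s')
    & last b s' = w].
  elim: s s0 s0S ss us wE => [|y s IHs] x xS; first by move=> _ _ xw; rewrite -xw xS in wS.
  move=> /= /andP[xy ys] /andP[xs us] wE.
  have [yS|yS] := boolP (y \in S); first exact: (IHs y).
  by exists x, y, s; split=> //; split=> //; apply/andP.
have bB : b \in outer_boundary adj S.
  by rewrite !inE bS; apply/exists_inP; exists a => //; rewrite adj_sym.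
have wb : w != b by apply: contraNneq wB => ->.
exists b; split=> //; apply/pred0P => x /=; apply/negbTE/andP => -[xS].
rewrite inE avoid_connect_sym // => xw.
have := path_separates adj_sym adj_irr adj_acyclic (c := b) (s := b :: s') _ us'.
rewrite /= ab bs wE' mem_head eq_sym => /(_ isT isT wb) /negP; apply.
have := connected_in_branch Sc bS aS => /fintype.subsetP/(_ x xS).
by rewrite !inE => /connect_trans; apply.
Qed.

Lemma altsum_outer_boundary S Q : connected_in adj S -> S != finset.set0 ->
  outer_boundary adj S \subset Q -> [disjoint Q & S] ->
  altsum S (fun L => f (Q :|: L)) =
  altsum S (fun L => f (outer_boundary adj S :|: L)).
Proof.
move=> Sc S0; have [n] := ubnP #|Q :\: outer_boundary adj S|.
elim: n Q => // n IHn Q Qn BQ QS.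
have [/eqP|/set0Pn[w]] := eqVneq (Q :\: outer_boundary adj S) finset.set0.
  by rewrite finset.setD_eq0 => QB; have -> : Q = outer_boundary adj S
    by apply/eqP; rewrite finset.eqEsubset QB.
rewrite inE => /andP[wB wQ].
have wS : w \notin S by rewrite (disjointFr QS wQ).
have [b [bB wb SU]] := outer_separator Sc S0 wS wB.
have bQ : b \in Q by apply: (fintype.subsetP BQ).
rewrite -(IHn (Q :\ w)); first last.
- by apply: disjointWl QS; apply: subD1set.
- by rewrite subsetD1 BQ wB.
- rewrite -ltnS; apply: leq_trans Qn; rewrite ltnS; apply: proper_card.
  rewrite finset.setDDl finset.setUC -finset.setDDl; apply: properD1.
  by rewrite inE wB.
(* The Markov property at [b] splits both arguments. The parts in the branch of [w] do not involve
   [L], and the other parts agree, so the difference is constant in [L]. *)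
apply/eqP; rewrite -subr_eq0 -altsumN -altsumD; apply/eqP.
have /set0Pn[s0 s0S] := S0.
pose U := branch adj b w.
rewrite (@eq_altsum _ _ _ _
  (fun=> f (b |: (Q :&: U)) - f (b |: ((Q :\ w) :&: U)))).
  exact: (altsum_toggle s0S).
move=> L /fintype.subsetP LS.
rewrite (@markov_branch b w (Q :|: L)) ?(@markov_branch b w (Q :\ w :|: L)) //;
  rewrite ?inE ?bQ ?(eq_sym b) ?wb //.
have LU x : x \in L -> (x \in U) = false by move=> /LS; apply: disjointFr SU.
have -> : (Q :|: L) :&: branch adj b w = Q :&: U.
  apply/setP => x; rewrite -/U !finset.in_setI finset.in_setU.
  by case: (boolP (x \in L)) => [/LU ->|]; rewrite ?andbF ?orbF.
have -> : (Q :\ w :|: L) :&: branch adj b w = (Q :\ w) :&: U.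
  apply/setP => x; rewrite -/U !finset.in_setI finset.in_setU.
  by case: (boolP (x \in L)) => [/LU ->|]; rewrite ?andbF ?orbF.
have -> : (Q :\ w :|: L) :\: branch adj b w = (Q :|: L) :\: branch adj b w.
  apply/setP => x; rewrite !inE; case: eqP => [->|//]; by rewrite connect0.
by rewrite -[X in X - _]addrA -[X in _ - X]addrA opprD addrACA subrr addr0.
Qed.

(** Vertices [a] that are not leaves are dropped from [B] one at a time. The subsets containing [a]
    contribute nothing: [a] has two neighbors in [S], each of their branches contains a leaf, and
    [a] separates these leaves. *)
Lemma altsum_inner_boundary S B Q : connected_in adj S -> (1 < #|S|)%N ->
  inner_boundary adj S \subset B -> B \subset S ->
  altsum B (fun L => f (Q :|: L)) =
  altsum (inner_boundary adj S) (fun L => f (Q :|: L)).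
Proof.
move=> Sc S2; have [n] := ubnP #|B :\: inner_boundary adj S|.
elim: n B => // n IHn B Bn IB BS.
have [/eqP|/set0Pn[a]] := eqVneq (B :\: inner_boundary adj S) finset.set0.
  by rewrite finset.setD_eq0 => BI; have -> : B = inner_boundary adj S
    by apply/eqP; rewrite finset.eqEsubset BI.
rewrite inE => /andP[aI aB]; have aS := fintype.subsetP BS a aB.
have BaS : B :\ a \subset S by apply: fintype.subset_trans BS; apply: subD1set.
have IBa : inner_boundary adj S \subset B :\ a by rewrite subsetD1 IB.
rewrite -(IHn (B :\ a)) //; last first.
  rewrite -ltnS; apply: leq_trans Bn; rewrite ltnS; apply: proper_card.
  rewrite finset.setDDl finset.setUC -finset.setDDl; apply: properD1.
  by rewrite inE aI.
rewrite -[in LHS](finset.setD1K aB) altsum_setU1 ?setD11 //.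
rewrite (@eq_altsum _ _ _ (fun L => f (Q :|: (a |: L)))
  (fun L => f ((a |: Q) :|: L))); last first.
  by move=> L _; rewrite finset.setUCA finset.setUA.
have [x xS ax] := connected_in_neighbor Sc aS S2.
have : #|[set v' in S | adj a v']| != 1%N by move: aI; rewrite inE aS.
rewrite (cardsD1 x) !inE xS ax /= eqSS -lt0n card_gt0 => /set0Pn[y].
rewrite !inE => /and3P[yx yS ay].
have [l lI lx] := branch_leaf adj_sym adj_irr adj_acyclic aS xS ax.
have [m mI my] := branch_leaf adj_sym adj_irr adj_acyclic aS yS ay.
rewrite (@altsum_cut a x (a |: Q) _ l m) ?subr0 ?finset.setU11 //.
- by apply: contraTneq ax => ->; rewrite adj_irr.
- exact: (fintype.subsetP IBa).
- exact: (fintype.subsetP IBa).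
apply: contra yx => mx; rewrite eq_sym; apply/eqP.
apply: (neighbors_branch adj_sym adj_irr adj_acyclic ax ay).
move: mx my; rewrite !inE => /connect_trans mx.
by rewrite avoid_connect_sym // => /mx.
Qed.

(** The branch at [j] through a neighbor in [S] contains a leaf but not [j]. *)
Lemma other_leaf S j : connected_in adj S -> (1 < #|S|)%N ->
  j \in inner_boundary adj S -> exists2 l, l \in inner_boundary adj S & l != j.
Proof.
move=> Sc S2 jI; have jS := fintype.subsetP (inner_boundary_subset adj S) j jI.
have [x xS jx] := connected_in_neighbor Sc jS S2.
have [l lI lx] := branch_leaf adj_sym adj_irr adj_acyclic jS xS jx.
exists l => //; apply: contraTneq lx => ->; apply: center_notin_branch.
by apply: contraTneq jx => ->; rewrite adj_irr.
Qed.

(** The branch at [j] through its only neighbor in [S] contains the rest of [S] and, among outer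
    vertices, exactly those not adjacent to [j]. Cutting there detaches [j] with its outer
    neighbors, at a cost independent of [J] and [M]. *)
Lemma markov_leaf S j J M : connected_in adj S ->
  j \in inner_boundary adj S -> J \subset S -> j \in J -> M \subset J ->
  j \notin M ->
  f (J :|: (outer_boundary adj S :\: outer_boundary_at adj S M)) =
  f (J :|: (outer_boundary adj S :\: outer_boundary_at adj S (j |: M))) +
  (f (j |: outer_boundary_at adj S [set j]) - f [set j]).
Proof.
move=> Sc jI /fintype.subsetP JS jJ /fintype.subsetP MJ jM.
have jS := JS j jJ.
move: jI; rewrite inE jS => /cards1P[s sE].
have /andP[sS js] : (s \in S) && adj j s.
  by have := set11 s; rewrite -sE inE.
have sj : s != j by apply: contraTneq js => ->; rewrite adj_irr.
pose U := branch adj j s; pose Bd := outer_boundary adj S.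
(* A simple path in [S] from [j] must step to [s] first and never returns to [j]. *)
have SU x : x \in S -> (x \in U) = (x != j).
  move=> xS; have [->|xj] := eqVneq x j.
    by apply/negbTE/center_notin_branch.
  have [[|y p] [jp up xE pS]] := connected_in_path Sc jS xS.
    by rewrite -xE eqxx in xj.
  have ys : y = s.
    apply/set1P; rewrite -sE inE pS ?inE ?eqxx ?orbT //.
    by case/andP: jp.
  move: jp up xE; rewrite ys => /= /andP[_ sp] /andP[jp _] <-.
  exact: path_branch.
have atE x M' : (x \in outer_boundary_at adj S M') =
    (x \in Bd) && [exists v in M', adj x v] by rewrite inE.
have at1E x : (x \in outer_boundary_at adj S [set j]) = (x \in Bd) && adj x j.
  rewrite atE; congr (_ && _); apply/exists_inP/idP => [[v]|xj].
    by rewrite inE => /eqP ->.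
  by exists j => //; rewrite inE.
have BS x : x \in Bd -> x \notin S by rewrite 2!inE => /andP[].
have BU x : x \in Bd -> (x \in U) = ~~ adj x j.
  move=> xB; apply/idP/idP => [xU|xj].
    apply: contra (BS x xB) => xj.
    rewrite -(@neighbors_branch _ adj adj_sym adj_irr adj_acyclic j s x) //.
    by rewrite adj_sym.
  move: (xB); rewrite inE => /andP[_ /exists_inP[v vS xv]].
  apply: (@branch_closed _ adj j s v); rewrite // ?SU //.
  - by apply: contraNneq xj => <-.
  - by rewrite adj_sym.
  - by apply: contraNneq (BS x xB) => ->.
(* With [BU], no outer vertex is adjacent to both [j] and [M], so removing the outer neighbors of
   [M] removes none of those of [j]. *)
have MU x : x \in Bd -> [exists v in M, adj x v] -> x \in U.
  move=> xB /exists_inP[v vM xv]; apply: (@branch_closed _ adj j s v) => //.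
  - by rewrite -/U SU ?JS ?MJ //; apply: contraNneq jM => <-.
  - by rewrite adj_sym.
  - by apply: contraNneq (BS x xB) => ->.
have jU : j \in U = false by rewrite SU // eqxx.
have exU x : [exists v in j |: M, adj x v] =
    adj x j || [exists v in M, adj x v].
  apply/exists_inP/orP => [[v]|[xj|/exists_inP[v vM xv]]].
  - by rewrite in_setU1 => /orP[/eqP ->|vM] xv; [left|right; apply/exists_inP; exists v].
  - by exists j; rewrite // setU11.
  - by exists v; rewrite // in_setU1 vM orbT.
rewrite (@markov_branch j s) // ?finset.in_setU ?jJ // -/U -/Bd addrA.
congr (f _ + f _ - _); apply/setP => x.
  rewrite in_setU1 finset.in_setI !finset.in_setU !finset.in_setD !atE exU.
  have [->|xj] := eqVneq x j; first by rewrite jJ.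
  have [xB|xB] := boolP (x \in Bd).
    rewrite (contraNF (JS x) (BS x xB)) /= andbT BU //.
    by rewrite negb_or andbC !andbT.
  rewrite !andbF !orbF; case: (boolP (x \in J)) => //= xJ.
  by rewrite SU ?JS.
rewrite finset.in_setD in_setU1 finset.in_setU finset.in_setD at1E atE.
have [->|xj] := eqVneq x j; first by rewrite jU jJ.
have [xB|xB] := boolP (x \in Bd).
  rewrite (contraNF (JS x) (BS x xB)) /= andbT BU // negbK.
  case: (boolP (adj x j)) => //= xj'; apply/negP => /(MU x xB).
  by rewrite BU // xj'.
rewrite andbF orbF /=; case: (boolP (x \in J)) => [xJ|]; rewrite ?andbF //.
by rewrite SU ?JS // xj.
Qed.

Lemma altsum_complement S : S != finset.set0 ->
  altsum S (fun L => f (~: S :|: L)) =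
  if connected_in adj S && (2 <= #|S|)%N then
    altsum (inner_boundary adj S)
      (fun J => f (J :|: (outer_boundary adj S :\: outer_boundary_at adj S J)))
  else if [exists v, S == [set v]] then
    f (outer_boundary adj S) - f (S :|: outer_boundary adj S)
  else 0.
Proof.
move=> S0; have [Sc|Sc] := boolP (connected_in adj S); last first.
  rewrite altsum_disconnected //; case: existsP => // -[v /eqP SE].
  case/negP: Sc; rewrite SE; apply/forall_inP => x /set1P ->.
  by apply/forall_inP => y /set1P ->; rewrite connect0.
pose Bd := outer_boundary adj S; pose I := inner_boundary adj S.
have BS : Bd \subset ~: S.
  by apply/fintype.subsetP => x; rewrite inE => /andP[].
rewrite altsum_outer_boundary //; last first.
  by rewrite -setI_eq0 finset.setIC finset.setICr.
have [S2|S1] := ltnP 1 #|S|; last first.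
  have {}S1 : #|S| == 1%N by rewrite eqn_leq S1 card_gt0.
  have /cards1P[v SE] := S1.
  have -> : [exists v, S == [set v]] by apply/existsP; exists v; rewrite SE.
  rewrite -/Bd SE -[X in altsum X](finset.setU0 [set v]) altsum_setU1 ?inE //.
  by rewrite !altsum0 !finset.setU0 finset.setUC.
have -> : altsum S (fun L => f (Bd :|: L)) = altsum I (fun L => f (Bd :|: L)).
  by apply: altsum_inner_boundary; rewrite ?inner_boundary_subset.
have at0 : outer_boundary_at adj S finset.set0 = finset.set0.
  apply/setP => x; rewrite !inE; apply/negbTE; rewrite negb_and.
  by apply/orP; right; apply/exists_inP => -[v]; rewrite inE.
(* [K] collects the leaves whose outer neighbors are already removed. It grows from the empty set,
   where the whole boundary is present, to [I], which is the claim. *)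
suff step K : K \subset I -> altsum I (fun J => f (Bd :|: J)) =
    altsum I (fun J => f (J :|: (Bd :\: outer_boundary_at adj S (J :&: K)))).
  rewrite (step I) //; apply: eq_altsum => J JI.
  by rewrite (finset.setIidPl JI).
have [n] := ubnP #|K|; elim: n K => // n IHn K Kn KI.
have [->|/set0Pn[j jK]] := eqVneq K finset.set0.
  by apply: eq_altsum => J _; rewrite finset.setI0 at0 finset.setD0 finset.setUC.
have jI := fintype.subsetP KI j jK.
rewrite (IHn (K :\ j)); first last.
- by apply: fintype.subset_trans KI; apply: subD1set.
- by rewrite -ltnS; apply: leq_trans Kn; rewrite ltnS proper_card // properD1.
(* [h] is the cost from [markov_leaf]. It depends only on whether [j] is in [J], so toggling a
   second leaf [l] shows that its alternating sum is zero. *)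
pose h J := if j \in J
  then f (j |: outer_boundary_at adj S [set j]) - f [set j] else 0.
have [l lI lj] := other_leaf Sc S2 jI.
rewrite -[RHS]addr0 -(@altsum_toggle _ _ l I h) //; last first.
  by move=> L; rewrite /h in_setU1 eq_sym (negPf lj).
rewrite -altsumD; apply: eq_altsum => J JI; rewrite /h.
have [jJ|jJ] := boolP (j \in J); last first.
  rewrite addr0; congr (f (_ :|: (_ :\: outer_boundary_at _ _ _))).
  apply/setP => x; rewrite !inE; have [->|//] := eqVneq x j.
  by rewrite (negPf jJ).
rewrite (@markov_leaf S j J (J :&: (K :\ j))) //.
- congr (f (_ :|: (_ :\: outer_boundary_at _ _ _)) + _).
  apply/setP => x; rewrite !inE; have [->|//] := eqVneq x j.
  by rewrite jJ jK.
- by apply: fintype.subset_trans JI (inner_boundary_subset _ _).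
- exact: subsetIl.
- by rewrite !inE eqxx andbF.
Qed.

End MarkovAlternatingSums.

(** * Finite additivity over disjoint unions *)

Section FiniteAdditivity.
Local Open Scope classical_set_scope.
Context {d : measure_display} {Om : measurableType d} {R : realType}.

(** Only additivity is assumed of [mu], so that the lemma serves both the probability and the signed
    measure. *)
Lemma additive2_fin_bigcup (mu : set Om -> \bar R) (F : finType)
    (E : F -> set Om) (D : pred F) :
  additive2 mu -> mu set0 = 0%E -> (forall i, measurable (E i)) ->
  (forall i j w, E i w -> E j w -> i = j) ->
  mu (\bigcup_(i in [set` D]) E i) = (\sum_(i in D) mu (E i))%E.
Proof.
move=> muU mu0 mE dE; rewrite bigcup_pred.
have := index_enum_uniq F; elim: (index_enum F) => [|i s IHs] /=.
  by rewrite !big_nil.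
move=> /andP[iNs us]; rewrite !big_cons.
case: ifPn => Di; last exact: IHs.
rewrite muU ?IHs //.
- exact: bigsetU_measurable.
- apply/seteqP; split=> // w [Eiw]; rewrite -bigcup_seq_cond.
  by move=> [j /= /andP[js _] Ejw]; rewrite (dE i j w) ?js in iNs.
Qed.

End FiniteAdditivity.

(** * The Markov property of tree-indexed chains *)

Section TreeMarkovChain.
Local Open Scope classical_set_scope.
Context {d : measure_display} {Om : measurableType d} {R : realType}
  {P : probability Om R}.
Context {T : finType} (adj : rel T) (o : T).
Hypotheses (adj_sym : symmetric adj)
  (adj_conn : connected_in adj [set: T]%SET).
Implicit Types (X : T -> {RV P >-> bool}) (A U : {set T}) (v : T).

Lemma measurable_RV (Y : {RV P >-> bool}) (B : set bool) :
  measurable (Y @^-1` B).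
Proof. by apply: measurable_funPTI. Qed.

Lemma measurable_zero_on X A : measurable (zero_on X A).
Proof.
have -> : zero_on X A = \bigcap_(v in [set` A]) (X v @^-1` [set false]) by [].
by apply: fin_bigcap_measurable => // v _; apply: measurable_RV.
Qed.

Lemma shortest_path v : exists s,
  [/\ path adj o s, uniq (o :: s), last o s = v &
    forall s', path adj o s' -> uniq (o :: s') -> last o s' = v ->
      (size s <= size s')%N].
Proof.
pose Q n := `[< exists s, [/\ path adj o s, uniq (o :: s), last o s = v
                         & size s = n] >].
have exQ : exists n, Q n.
  have [s [os us sv]] := tree_path adj_conn o v.
  by exists (size s); apply/asboolP; exists s.
case: (ex_minnP exQ) => n /asboolP[s [os us sv sn]] min_n.
exists s; split=> // s' os' us' sv'; rewrite sn min_n //.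
by apply/asboolP; exists s'.
Qed.

(** The parent is the next-to-last vertex of a chosen shortest path from the root, and [depth] is
    the distance to the root. Truncating the path shows that the depth drops, which allows induction
    along the tree. *)
Lemma exists_parent : exists (par : T -> T) (depth : T -> nat), forall v,
  v != o -> [/\ is_parent adj o (par v) v, adj (par v) v
              & (depth (par v) < depth v)%N].
Proof.
have [geo geoP] := choice shortest_path.
exists (fun v => last o (take (size (geo v)).-1 (geo v))).
exists (fun v => size (geo v)) => v vo.
have [] := geoP v; case/lastP: (geo v) => [|s w].
  by move=> _ _ /= ov; rewrite ov eqxx in vo.
rewrite last_rcons size_rcons /= => + + wv; rewrite wv => osv usv _.
rewrite -cats1 take_size_cat //; split; first by exists s.
  by move: osv; rewrite rcons_path => /andP[].
have [_ _ _ min_s] := geoP (last o s); rewrite ltnS; apply: min_s => //.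
  by move: osv; rewrite rcons_path => /andP[].
move: usv; rewrite /= rcons_uniq mem_rcons inE negb_or.
by case/andP=> /andP[_ ->] /andP[_ ->].
Qed.

Section Chain.
Variables (Rv : T -> {RV P >-> bool}) (C : {v : T | v != o} -> {RV P >-> bool}).
Variables (X : T -> {RV P >-> bool}) (par : T -> T) (depth : T -> nat).
Local Notation I := (T + {v : T | v != o})%type.
Local Notation Z := (fun i : I => match i with inl v => Rv v | inr v => C v end).
Hypotheses (Z_indep : mutually_independent Z)
  (X_root : forall w, X o w = Rv o w)
  (X_par : forall (v : {v : T | v != o}) w,
     X (sval v) w = if C v w then Rv (sval v) w else X (par (sval v)) w)
  (par_adj : forall v, v != o -> adj (par v) v)
  (par_depth : forall v, v != o -> (depth (par v) < depth v)%N).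

Local Notation state := ({ffun I -> bool} * {ffun T -> bool})%type.
Implicit Types y : state.

Definition atom y : set Om :=
  [set w | (forall i, Z i w = y.1 i) /\ (forall v, X v w = y.2 v)].

Definition solution y : bool :=
  (y.2 o == y.1 (inl o)) && [forall v : {v : T | v != o},
    y.2 (sval v) == if y.1 (inr v) then y.1 (inl (sval v))
                    else y.2 (par (sval v))].

(** The joint law of [Z] and [X]: the product of the marginals of [Z], carried by the states that
    obey the recursion of the chain. *)
Definition weight y : R :=
  if solution y then \prod_i fine (P (Z i @^-1` [set y.1 i])) else 0.

Lemma measurable_atom y : measurable (atom y).
Proof.
have -> : atom y = (\bigcap_(i in [set: I]) (Z i @^-1` [set y.1 i])) `&`
    (\bigcap_(v in [set: T]) (X v @^-1` [set y.2 v])).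
  by apply/seteqP; split=> w [wZ wX]; split=> i; do ?[exact: wZ|exact: wX];
    move=> _; [exact: wZ|exact: wX].
by apply: measurableI; apply: fin_bigcap_measurable => // i _;
  apply: measurable_RV.
Qed.

Lemma prob_atom y : P (atom y) = (weight y)%:E.
Proof.
rewrite /weight; case: ifPn => [|ysol]; last first.
  rewrite (_ : atom y = set0) ?measure0 //; apply/seteqP; split=> // w [wZ wX].
  case/negP: ysol; rewrite /solution -!wX -wZ X_root eqxx /=.
  by apply/forallP => v; rewrite -!wX -!wZ X_par.
case/andP=> /eqP yo /forallP yv.
(* On a solution the values of [X] follow from those of [Z] by induction on the depth, so only the
   conditions on the independent variables remain. *)
have -> : atom y = \bigcap_(i in [set i | i \in [set: I]%SET])
    (Z i @^-1` [set y.1 i]).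
  apply/seteqP; split=> w; first by case=> wZ _ i _; apply: wZ.
  move=> wZ; have {}wZ i : Z i w = y.1 i by apply: wZ; rewrite /= inE.
  split=> // v; have [n] := ubnP (depth v); elim: n v => // n IHn v vn.
  have [->|vo] := eqVneq v o; first by rewrite X_root yo -wZ.
  pose v' : {v : T | v != o} := exist _ v vo.
  have /eqP := yv v'; rewrite -[v]/(sval v') => ->; rewrite X_par -!wZ.
  by rewrite IHn // (leq_trans (par_depth vo)).
rewrite (Z_indep _ (fun i => _)) // -prodEFin.
apply: eq_big => [i|i _]; first by rewrite inE.
by rewrite fineK // fin_num_measure //; apply: measurable_RV.
Qed.

Definition zero_state A y : bool := [forall v in A, ~~ y.2 v].

Lemma prob_zero_on A :
  fine (P (zero_on X A)) = \sum_(y | zero_state A y) weight y.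
Proof.
have -> : zero_on X A = \bigcup_(y in [set` zero_state A]) atom y.
  apply/seteqP; split=> w.
    move=> wA; exists ([ffun i => Z i w], [ffun v => X v w]).
      by apply/forall_inP => v /wA; rewrite ffunE => ->.
    by split=> i; rewrite ffunE.
  by move=> [y /forall_inP yA [_ wX]] v /yA; rewrite wX => /negbTE.
rewrite additive2_fin_bigcup //.
- by rewrite (eq_bigr _ (fun y _ => prob_atom y)) sumEFin.
- exact: measureU.
- exact: measurable_atom.
move=> [y1 y2] [y1' y2'] w [/= wZ wX] [/= wZ' wX'].
have -> : y1 = y1' by apply/ffunP => i; rewrite -wZ -wZ'.
by have -> : y2 = y2' by apply/ffunP => v; rewrite -wX -wX'.
Qed.

Definition vertex (i : I) : T := match i with inl v => v | inr v => sval v end.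

(* Exchanging the coordinates in D between two independent copies of the chain
   preserves the product of their weights; this gives the Markov property
   without computing any conditional law. *)
Definition mix (D : {set T}) y y' : state :=
  ([ffun i => if vertex i \in D then y.1 i else y'.1 i],
   [ffun v => if v \in D then y.2 v else y'.2 v]).

Lemma mixK D y y' : mix D (mix D y y') (mix D y' y) = y.
Proof.
case: y => y1 y2; rewrite /mix /=.
by congr (_, _); apply/ffunP => i; rewrite !ffunE; case: (_ \in D).
Qed.

(** The recursion at [v] involves only [v] and its parent. They lie on the same side of [D] unless
    the parent is [c], where the two copies agree. *)
Lemma solution_mix c (D : {set T}) y y' :
  (forall v, v != o -> par v != c -> (v \in D) = (par v \in D)) ->
  y.2 c = y'.2 c -> solution y -> solution y' -> solution (mix D y y').
Proof.
move=> Dpar yc /andP[yo /forallP yv] /andP[yo' /forallP yv'].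
apply/andP; split; first by rewrite !ffunE; case: ifP.
apply/forallP => v; rewrite !ffunE /=.
have -> : (if par (sval v) \in D then y.2 (par (sval v)) else y'.2 (par (sval v)))
    = if sval v \in D then y.2 (par (sval v)) else y'.2 (par (sval v)).
  have [pc|pc] := eqVneq (par (sval v)) c; first by rewrite pc yc !if_same.
  by rewrite -Dpar //; case: v {pc}.
by case: ifP => _.
Qed.

(** For two solutions, mixing only permutes the factors of the two products. Otherwise the mixed
    states are not both solutions either, since mixing undoes itself, and both sides are zero. *)
Lemma weight_mix c (D : {set T}) y y' :
  (forall v, v != o -> par v != c -> (v \in D) = (par v \in D)) ->
  y.2 c = y'.2 c -> weight y * weight y' =
  weight (mix D y y') * weight (mix D y' y).
Proof.
move=> Dpar yc; rewrite /weight.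
have [/andP[sy sy']|sN] := boolP (solution y && solution y').
  rewrite sy sy' !(solution_mix Dpar) // -!big_split; apply: eq_bigr => i _.
  by rewrite /= !ffunE; case: ifP => // _; rewrite mulrC.
have [/andP[sm sm']|] :=
  boolP (solution (mix D y y') && solution (mix D y' y)).
  have myc : (mix D y y').2 c = (mix D y' y).2 c by rewrite !ffunE yc.
  case/negP: sN; rewrite -(mixK D y y') (solution_mix Dpar myc) //=.
  by rewrite -(mixK D y' y) (solution_mix Dpar (esym myc)).
rewrite negb_and => sNm; rewrite negb_and in sN.
have zero (b b' : bool) (x x' : R) : ~~ b || ~~ b' ->
    (if b then x else 0) * (if b' then x' else 0) = 0.
  by case/orP=> /negPf ->; rewrite ?mulr0 ?mul0r.
by rewrite !zero.
Qed.

Lemma chain_markov c U A : c \in A -> c \notin U ->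
  (forall u v, u \in U -> adj u v -> v != c -> v \in U) ->
  fine (P (zero_on X A)) * fine (P (zero_on X [set c]%SET)) =
  fine (P (zero_on X (c |: (A :&: U))%SET)) * fine (P (zero_on X (A :\: U)%SET)).
Proof.
move=> cA cU Ucl.
(* The recursion at [c] reads the parent of [c], so [c] is put on the side of its parent. This does
   not disturb the events, as the chain is 0 at [c] in both copies. *)
pose D := (if (c != o) && (par c \in U) then c |: U else U)%SET.
have DU v : v != c -> (v \in D) = (v \in U).
  by move=> vc; rewrite /D; case: ifP => // _; rewrite in_setU1 (negPf vc).
have Dpar v : v != o -> par v != c -> (v \in D) = (par v \in D).
  move=> vo pc; rewrite (DU (par v)) //; have [vc|vc] := eqVneq v c.
    by rewrite /D -vc vo /=; case: ifP => //; rewrite ?setU11 // vc (negPf cU).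
  rewrite DU //; apply/idP/idP => vU.
    by apply: Ucl vU _ pc; rewrite adj_sym par_adj.
  by apply: Ucl vU _ vc; apply: par_adj.
rewrite !prob_zero_on !big_distrlr !pair_big /=.
pose sw (yy : state * state) := (mix D yy.1 yy.2, mix D yy.2 yy.1).
have swK : involutive sw.
  by case=> y y'; rewrite /sw /= !mixK.
rewrite [RHS](reindex_inj (inv_inj swK)) /=.
(* Either condition forces both copies to vanish at [c]. The zeros of the first copy on [A] are then
   shared out: those in [U] go to the first mixed state, the others to the second. *)
have condE yy : zero_state A yy.1 && zero_state [set c]%SET yy.2 =
    zero_state (c |: A :&: U)%SET (sw yy).1 && zero_state (A :\: U)%SET (sw yy).2.
  case: yy => y y' /=; apply/andP/andP => -[/forall_inP h /forall_inP h'].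
    have yc := h c cA; have yc' := h' c (set11 c).
    split; apply/forall_inP => v; rewrite !finset.inE !ffunE.
      by have [->|vc] := eqVneq v c; [case: ifP|rewrite DU //= => /andP[/h ? ->]].
    have [->|vc] := eqVneq v c; first by case: ifP.
    by rewrite DU //= => /andP[/negbTE -> /h].
  have mc := h c (setU11 _ _).
  have mc' : ~~ (mix D y' y).2 c by apply: h'; rewrite finset.inE cU.
  have [yc yc'] : ~~ y.2 c /\ ~~ y'.2 c.
    by move: mc mc'; rewrite !ffunE; case: ifP.
  split; apply/forall_inP => v; last by rewrite finset.inE => /eqP ->.
  move=> vA; have [->//|vc] := eqVneq v c.
  have [vU|vU] := boolP (v \in U).
    by have := h v; rewrite !finset.inE vA vU orbT ffunE DU // vU => /(_ isT).
  have := h' v; rewrite !finset.inE vA vU ffunE DU // (negPf vU).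
  exact.
rewrite (eq_bigl _ _ condE); apply: eq_bigr => -[y y'] /=.
rewrite -(condE (y, y')) => /andP[/forall_inP h /forall_inP h'].
apply: (@weight_mix c) => //.
by rewrite (negPf (h c cA)) (negPf (h' c (set11 c))).
Qed.

End Chain.

Lemma tree_markov_chain_markov r p X c U A :
  tree_markov_chain adj o r p X -> c \in A -> c \notin U ->
  (forall u v, u \in U -> adj u v -> v != c -> v \in U) ->
  fine (P (zero_on X A)) * fine (P (zero_on X [set c]%SET)) =
  fine (P (zero_on X (c |: (A :&: U))%SET)) * fine (P (zero_on X (A :\: U)%SET)).
Proof.
move=> [Rv [C [Zi _ _ Xo Xv]]].
have [par [depth parP]] := exists_parent.
apply: (@chain_markov Rv C X par depth) => //.
- by move=> v w; apply: Xv; have [] := parP _ (svalP v).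
- by move=> v /parP[].
- by move=> v /parP[].
Qed.

End TreeMarkovChain.

(** * Moebius inversion of the signed measure *)

Section MoebiusInversion.
Context {d : measure_display} {Om : measurableType d} {R : realType}
  {P : probability Om R}.
Context {T : finType} (o : T) (X : T -> {RV P >-> bool}).
Context (nu : {charge set (nonempty_set o) -> \bar R}).
Implicit Types (B I L S : {set T}).

Definition log_prob_zero I : R := ln (fine (P (zero_on X I))).

Lemma charge_finite_sum (D : pred (nonempty_set o)) :
  nu [set` D]%classic = (\sum_(B | D B) fine (nu [set B]%classic))%:E.
Proof.
have -> : [set` D]%classic = (\bigcup_(B in [set` D]) [set B])%classic.
  by apply/seteqP; split=> [B DB|B [B' DB' ->] //]; exists B.
rewrite additive2_fin_bigcup //.
- by rewrite -sumEFin; apply: eq_bigr => B _; rewrite fineK // fin_num_measure.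
- exact: chargeU.
- exact: charge0.
by move=> B B' w /= -> ->.
Qed.

(** For [B = S] the indicator is 1 minus that of [L = set0]. If [B] strictly contains [S], it always
    meets [~: S] and the indicator is constant; if [B] misses some [a] in [S], toggling [a] changes
    nothing. *)
Lemma altsum_meets S B : S != finset.set0 ->
  altsum S (fun L => (B :&: (~: S :|: L) != finset.set0)%:R : R) =
  - (B == S)%:R.
Proof.
case/set0Pn => s sS; have [->|BS] := eqVneq B S.
  rewrite (@eq_altsum _ _ _ _ (fun L => 1 + - (L == finset.set0)%:R)).
    rewrite altsumD altsumN (altsum_toggle sS) // add0r; congr (- _).
    rewrite /altsum (bigD1 finset.set0) ?finset.sub0set //= eqxx cards0.
    rewrite expr0 mul1r big1 ?addr0 // => L /andP[_ /negPf ->].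
    by rewrite mulr0.
  move=> L LS; rewrite finset.setIUr finset.setICr finset.set0U.
  by rewrite (finset.setIidPr LS); case: eqP => _; rewrite ?subrr ?subr0.
rewrite oppr0; have [SB|/fintype.subsetPn[a aS aB]] := boolP (S \subset B).
  have [b bB bS] : exists2 b, b \in B & b \notin S.
    by apply/fintype.subsetPn; move: BS; rewrite finset.eqEsubset SB andbT.
  apply: (altsum_toggle sS) => L; congr (_%:R).
  have ne L' : B :&: (~: S :|: L') != finset.set0.
    by apply/set0Pn; exists b; rewrite !finset.inE bB bS.
  by rewrite !ne.
apply: (altsum_toggle aS) => L; congr ((_ != _)%:R).
apply/setP => x; rewrite !finset.inE; have [->|//] := eqVneq x a.
by rewrite (negPf aB).
Qed.

(** This is Moebius inversion with [L] the complement in [S] of the usual summation index. Each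
    log-probability is minus a sum of point masses, and [altsum_meets] singles out the mass at
    [S]. *)
Lemma signed_measure_set1 S (hS : S != finset.set0) :
  corresponding_signed_measure X nu ->
  nu [set (exist _ S hS : nonempty_set o)]%classic =
  (altsum S (fun L => log_prob_zero (~: S :|: L)))%:E.
Proof.
move=> hnu; pose m (B : nonempty_set o) := fine (nu [set B]%classic).
have fE I : log_prob_zero I =
    - \sum_(B : nonempty_set o) (sval B :&: I != finset.set0)%:R * m B.
  have [E] := etrans (esym (hnu I))
    (charge_finite_sum (fun B : nonempty_set o => sval B :&: I != finset.set0)).
  rewrite /log_prob_zero -[LHS]opprK E big_mkcond; congr (- _).
  by apply: eq_bigr => B _; case: eqP => _; rewrite ?mul0r ?mul1r.
rewrite (eq_altsum (fun L _ => fE _)) altsumN.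
rewrite /altsum; under eq_bigr do rewrite big_distrr /=.
rewrite exchange_big /=.
under eq_bigr => B _.
  under eq_bigr do rewrite mulrA.
  rewrite -big_distrl /= -/(altsum S _) altsum_meets // mulNr.
  over.
rewrite sumrN opprK (bigD1 (exist _ S hS)) //= eqxx mul1r big1 ?addr0.
  by rewrite /m fineK // fin_num_measure.
move=> B BS; case: eqP => [E|_]; last by rewrite mul0r.
by case/eqP: BS; apply: val_inj.
Qed.

End MoebiusInversion.

(** * The signed measure of a tree-indexed Markov chain *)

Theorem lemma4p3 (d : measure_display) (Omega : measurableType d)
    (R : realType) (P : probability Omega R)
    (T : finType) (adj : rel T) (o : T)
    (r : T -> R) (p : {set T} -> R) (X : T -> {RV P >-> bool})
    (nu : {charge set (nonempty_set o) -> \bar R})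
    (hT : is_tree adj)
    (hr : forall v, 0 <= r v <= 1)
    (hp : forall u v, adj u v -> 0 <= p [set u; v]%SET <= 1)
    (hX : tree_markov_chain adj o r p X)
    (hpos : (0 < P (zero_on X [set: T]%SET))%E)
    (hnu : corresponding_signed_measure X nu)
    (S : {set T}) (hS : S != finset.set0) :
  nu [set (exist _ S hS : nonempty_set o)]%classic =
  (if connected_in adj S && (2 <= #|S|)%N then
     \sum_(J : {set T} | J \subset inner_boundary adj S)
       (-1) ^+ #|J| *
       ln (fine (P (zero_on X
         (J :|: (outer_boundary adj S :\: outer_boundary_at adj S J))%SET)))
   else if [exists v, S == [set v]%SET] then
     - ln (cond_prob (P := P) (zero_on X (S :|: outer_boundary adj S)%SET)
                     (zero_on X (outer_boundary adj S)))
   else 0)%:E.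
Proof.
case: hT => adj_sym adj_irr adj_conn adj_acyclic.
(* Each such event contains the event of being zero everywhere. Positivity is what lets [ln] turn
   products and quotients into sums and differences. *)
have prob_gt0 A : 0 < fine (P (zero_on X A)).
  have PA : P (zero_on X A) \is a fin_num.
    by apply: fin_num_measure; apply: measurable_zero_on.
  rewrite -lte_fin fineK //; apply: lt_le_trans hpos _.
  apply: le_measure; rewrite ?inE; try exact: measurable_zero_on.
  by move=> w wT v _; apply: wT; rewrite inE.
have markov c (U A : {set T}) : c \in A -> c \notin U ->
    (forall x y, x \in U -> adj x y -> y != c -> y \in U) ->
    log_prob_zero X A + log_prob_zero X [set c]%SET =
    log_prob_zero X (c |: (A :&: U))%SET + log_prob_zero X (A :\: U)%SET.
  move=> cA cU Ucl; rewrite /log_prob_zero -!lnM ?posrE //.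
  by rewrite (tree_markov_chain_markov adj_sym adj_conn hX cA cU Ucl).
rewrite (signed_measure_set1 _ hnu); congr (_%:E).
rewrite (altsum_complement adj_sym adj_irr adj_conn adj_acyclic markov) //.
case: ifP => // _; case: ifP => // _.
rewrite /cond_prob (_ : zero_on X _ `&` _ = zero_on X (S :|: outer_boundary adj S))%classic.
  by rewrite ln_div ?posrE // opprB.
apply/seteqP; split=> w; first by case.
by move=> wS; split=> // v vB; apply: wS; rewrite finset.inE vB orbT.
Qed.
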